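(* Assume $M_y<0$, $4L_z^2\le -M_y$, $0<\alpha<\frac1{2(m-1)}$ and $$h\le\min\left\{\frac{-M_y}{4}\,\frac1{3(d+1)L_y^2},\ \Big(\frac{-M_y}{4}\,\frac{1}{6(d+1)L_y^2R_0^{2(m-1)}}\Big)^{\frac1{1-2(m-1)\alpha}}\right\}.$$ Then the discretized dynamics given by the Full-Projection scheme is contracting, with constant $c'=\frac{M_y}2<0$: for every $i\in\{0,\dots,N-1\}$ and all inputs $Y^1_{i+1},Y^2_{i+1}$ at time $t_{i+1}$, the corresponding one-step outputs $(Y^1_i,Z^1_i)$, $(Y^2_i,Z^2_i)$ satisfy $$|Y^1_i-Y^2_i|^2+\tfrac18|Z^1_i-Z^2_i|^2h\le e^{\frac{M_y}{2}h}\,\mathbb E_i\big[|Y^1_{i+1}-Y^2_{i+1}|^2\big].$$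
   Context: $T>0$; $W$ is a $d$-dimensional Brownian motion with its usual augmented filtration $(\mathcal F_t)_{t\in[0,T]}$; $t_i=ih$, $h=T/N$, $i=0,\dots,N$; $\mathbb E_i=\mathbb E[\cdot|\mathcal F_{t_i}]$. The driver $f:\mathbb R^n\times\mathbb R^{n\times d}\to\mathbb R^n$ satisfies, with $M_y\in\mathbb R$, $L_y,L_z\ge0$, integer $m\ge2$, for all $y,y',z,z'$: (Mon) $\langle y'-y,f(y',z)-f(y,z)\rangle\le M_y|y'-y|^2$; (RegY) $|f(y',z)-f(y,z)|\le L_y(1+|y'|^{m-1}+|y|^{m-1})|y'-y|$; (RegZ) $|f(y,z')-f(y,z)|\le L_z|z'-z|$. $T^h:\mathbb R^n\to\mathbb R^n$ is a projection on the ball of radius $R^h=R_0h^{-\alpha}$ ($R_0>0$ constant), e.g. $T^h(y)=\min(1,R^h|y|^{-1})y$; it satisfies $|T^h(y)|\le|y|$, $|T^h(y)|\le R^h$, $T^h(y)=y$ when $|y|\le R^h$, and is $1$-Lipschitz. The weights $H_{i+1}$ are $\mathbb R^{d\times1}$-valued $\mathcal F_{t_{i+1}}$-measurable random variables, independent of $\mathcal F_{t_i}$, with $\mathbb E_i[H_{i+1}]=0$, $\mathbb E_i[H_{i+1}H_{i+1}^*]=\Lambda h^{-1}I_d$, $\Lambda=\Lambda(h)\in(0,1]$, and $\max_i\mathbb E[|\frac{W_{t_{i+1}}-W_{t_i}}h-H_{i+1}|^2]\le Ch$ for a constant $C$. One step of the Full-Projection scheme maps an $\mathbb R^n$-valued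 $\mathcal F_{t_{i+1}}$-measurable random variable $Y_{i+1}$ (the input) to the output $(Y_i,Z_i)$ given by $Z_i=\mathbb E_i[T^h(Y_{i+1})H_{i+1}^*]$ and $Y_i=\mathbb E_i[T^h(Y_{i+1})+f(T^h(Y_{i+1}),Z_i)h]$. *)

(* Defs.v *)
From HB Require Import structures.
From mathcomp Require Import all_boot all_order all_algebra.
From mathcomp Require Import all_classical all_reals all_analysis.
From mathcomp Require Import measurable_realfun.

Set Implicit Arguments.
Unset Strict Implicit.
Unset Printing Implicit Defensive.

Import Order.TTheory GRing.Theory Num.Theory.
Import numFieldNormedType.Exports.

Local Open Scope classical_set_scope.
Local Open Scope ring_scope.

(* Vectors of R^n are column matrices 'cV[R]_n. The norm that the library puts *)
(* on matrices is the sup norm; |.| below is the Euclidean norm on R^n and the *)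
(* Frobenius norm on R^(n x d).                                                *)
Section euclidean.
Context {R : realType}.

Definition inner {n : nat} (x y : 'cV[R]_n) : R := \sum_(i < n) x i 0 * y i 0.

Definition enorm {p q : nat} (A : 'M[R]_(p, q)) : R :=
  Num.sqrt (\sum_(i < p) \sum_(j < q) A i j ^+ 2).

End euclidean.

Section driver.
Context {R : realType} {n d : nat}.
Implicit Types (f : 'cV[R]_n -> 'M[R]_(n, d) -> 'cV[R]_n) (Th : 'cV[R]_n -> 'cV[R]_n).

Definition driver_Mon f (My : R) : Prop := forall y y' z,
  inner (y' - y) (f y' z - f y z) <= My * enorm (y' - y) ^+ 2.

Definition driver_RegY f (Ly : R) (m : nat) : Prop := forall y y' z,
  enorm (f y' z - f y z) <=
    Ly * (1 + enorm y' ^+ (m - 1) + enorm y ^+ (m - 1)) * enorm (y' - y).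

Definition driver_RegZ f (Lz : R) : Prop := forall y z z',
  enorm (f y z' - f y z) <= Lz * enorm (z' - z).

Definition ball_projection (Rh : R) Th : Prop :=
  [/\ forall y, enorm (Th y) <= enorm y,
      forall y, enorm (Th y) <= Rh,
      forall y, enorm y <= Rh -> Th y = y
    & forall y y', enorm (Th y' - Th y) <= enorm (y' - y)].

End driver.

(* A sub-sigma-algebra of Om is given as a set of subsets G. *)
Section probability_notions.
Context {R : realType} {disp : measure_display} {Om : measurableType disp}.
Variable P : probability Om R.
Implicit Type G : set (set Om).

Definition measurable_wrt {disp' : measure_display} {U : measurableType disp'}
    G (X : Om -> U) : Prop :=
  preimage_set_system setT X measurable `<=` G.

Definition mx_measurable_wrt {p q : nat} G (X : Om -> 'M[R]_(p, q)) : Prop :=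
  forall i j, measurable_wrt G (fun w => X w i j).

Definition sigma_vec {d : nat} (X : Om -> 'cV[R]_d) : set (set Om) :=
  g_sigma_preimage (fun (j : 'I_d) (w : Om) => X w j 0).

Definition indep (G1 G2 : set (set Om)) : Prop :=
  forall A B, G1 A -> G2 B -> P (A `&` B) = (P A * P B)%E.

(* E is a version of E[X | G], for X integrable *)
Definition is_cond_exp G (X E : Om -> R) : Prop :=
  [/\ P.-integrable setT (EFin \o X),
      measurable_wrt G E,
      P.-integrable setT (EFin \o E)
    & forall A, G A ->
        (\int[P]_(w in A) (E w)%:E = \int[P]_(w in A) (X w)%:E)%E].

Definition is_mx_cond_exp {p q : nat} G (X E : Om -> 'M[R]_(p, q)) : Prop :=
  forall i j, is_cond_exp G (fun w => X w i j) (fun w => E w i j).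

(* E is a version of the [0, +oo]-valued E[X | G], for X >= 0 that need not be *)
(* integrable                                                                  *)
Definition is_nneg_cond_exp G (X : Om -> R) (E : Om -> \bar R) : Prop :=
  [/\ measurable_fun setT X,
      forall w, 0 <= X w,
      measurable_wrt G E,
      forall w, (0 <= E w)%E
    & forall A, G A ->
        (\int[P]_(w in A) E w = \int[P]_(w in A) (X w)%:E)%E].

End probability_notions.

Section brownian.
Context {R : realType} {disp : measure_display} {Om : measurableType disp}.
Variable P : probability Om R.
Context {d : nat}.
Implicit Type W : R -> Om -> 'cV[R]_d.

Definition past W (t : R) : set (set Om) :=
  \bigcup_(s in `[0, t]) sigma_vec (W s).

Definition natural_filtration W (t : R) : set (set Om) := <<s past W t >>.

Definition augmented_filtration W (t : R) : set (set Om) :=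
  <<s past W t `|` [set A | measurable A /\ P A = 0%E] >>.

(* The last clause says that the increment over [s, t] has law                 *)
(* N(0, (t - s) I_d); the second parameter of normal_prob is the standard      *)
(* deviation.                                                                  *)
Definition brownian_motion (T : R) W : Prop :=
  [/\ forall t j, t \in `[0, T] -> measurable_fun setT (fun w => W t w j 0),
      {ae P, forall w, W 0 w = 0},
      {ae P, forall w, forall j,
         {within `[0, T], continuous (fun t => W t w j 0)}},
      forall s t, 0 <= s -> s < t -> t <= T ->
        indep P (sigma_vec (fun w => W t w - W s w)) (natural_filtration W s)
    & forall s t, 0 <= s -> s < t -> t <= T ->
        forall B : 'I_d -> set R, (forall j, measurable (B j)) ->
        P [set w | forall j, B j (W t w j 0 - W s w j 0)] =
        (\prod_(j < d) normal_prob 0 (Num.sqrt (t - s)) (B j))%E].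

End brownian.

Section scheme.
Context {R : realType} {disp : measure_display} {Om : measurableType disp}.
Variable P : probability Om R.
Context {n d : nat}.

Definition tgrid (h : R) (i : nat) : R := i%:R * h.

Definition scheme_weights (W : R -> Om -> 'cV[R]_d) (h : R) (N : nat)
    (Lam C : R) (H : nat -> Om -> 'cV[R]_d) : Prop :=
  forall i, (i < N)%N ->
  let Fi := augmented_filtration P W (tgrid h i) in
  let Fi1 := augmented_filtration P W (tgrid h i.+1) in
  [/\ mx_measurable_wrt Fi1 (H i.+1),
      indep P (sigma_vec (H i.+1)) Fi,
      is_mx_cond_exp P Fi (H i.+1) (fun _ => 0),
      is_mx_cond_exp P Fi (fun w => H i.+1 w *m (H i.+1 w)^T)
        (fun _ => (Lam * h^-1)%:M)
    & ('E_P[fun w => (enorm (h^-1 *: (W (tgrid h i.+1) w - W (tgrid h i) w)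
                             - H i.+1 w) ^+ 2)%R] <= (C * h)%:E)%E].

(* One step: Yin is the input at t_(i+1), Hi1 is the weight H_(i+1), G is      *)
(* F_(t_i), and Y, Z are versions of the output.                               *)
Definition full_projection_step (G : set (set Om)) (h : R)
    (f : 'cV[R]_n -> 'M[R]_(n, d) -> 'cV[R]_n) (Th : 'cV[R]_n -> 'cV[R]_n)
    (Hi1 : Om -> 'cV[R]_d) (Yin : Om -> 'cV[R]_n)
    (Y : Om -> 'cV[R]_n) (Z : Om -> 'M[R]_(n, d)) : Prop :=
  is_mx_cond_exp P G (fun w => Th (Yin w) *m (Hi1 w)^T) Z /\
  is_mx_cond_exp P G (fun w => Th (Yin w) + h *: f (Th (Yin w)) (Z w)) Y.

End scheme.

(* Main.v *)
Require Import Defs.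
From HB Require Import structures.
From mathcomp Require Import all_boot all_order all_algebra.
From mathcomp Require Import all_classical all_reals all_analysis.
From mathcomp Require Import measurable_realfun.
From mathcomp Require Import ring lra.

Set Implicit Arguments.
Unset Strict Implicit.
Unset Printing Implicit Defensive.

Import Order.TTheory GRing.Theory Num.Theory.
Import numFieldNormedType.Exports.

Local Open Scope classical_set_scope.
Local Open Scope ring_scope.

(** Write dT, df, dZ for the differences of the projected inputs, of the driver
    values and of the outputs Z, and mu = - My, and let U = dT + h df, so that
    the difference dY of the outputs Y is E_i[U] and dZ = E_i[dT H^T].

    The difficulty is that the crude bound h |dZ|^2 <= E_i|dT|^2 is too large
    to be added to |dY|^2: the term in dZ has to be paid for by the variance
    that is lost when U is replaced by its conditional mean.  As 1 and the
    entries of sqrt(h) H are conditionally orthogonal with norms at most 1, a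
    Bessel inequality holds,
      |E_i U|^2 + h |E_i[U H^T]|^2 <= E_i|U|^2,
    and since E_i[U H^T] differs from dZ by E_i[h df H^T], it gives
      |dY|^2 + (h/2) |dZ|^2 <= E_i[|U|^2 + h^2 |df|^2]    (conditional_bessel).

    The integrand on the right is then bounded at each sample point.
    Split df = A + B into the change of y and the change of z.
    Monotonicity produces - 2 mu h |dT|^2 from the inner product of dT and A.
    On the ball of the projection the driver is Lipschitz in y, and the step
    size restriction makes h times the square of its Lipschitz constant at most
    mu / 4; moreover monotonicity and local Lipschitz continuity force
    mu <= (5/4) Ly, hence mu h <= 25/384, so that all terms of order h^2 are
    small.  Young's inequality and 4 Lz^2 <= mu give (energy_estimate)
      |U|^2 + h^2 |df|^2 <= (1 - mu h / 2) |dT|^2 + (3/8) h |dZ|^2,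
    and 1/2 - 3/8 = 1/8 is the constant of the theorem.  Finally
    1 - mu h / 2 <= exp (- mu h / 2) and |dT| <= |Yin1 - Yin2|.

    The conditional Bessel inequality is proved without conditional
    expectations of products such as df H^T or |U|^2: its left side is at most
    the supremum, over constant vectors a and matrices b with rational entries, of
    conditional expectations of linear combinations of U, dT H^T, H and H H^T,
    and each of these combinations is bounded at each sample point by
    |U|^2 + h^2 |df|^2 (affine_minorant).  Only linearity and monotonicity of
    conditional expectations are used. *)

(** * Frobenius inner product *)

Section frobenius.
Context {R : realType}.

Definition frob {p q : nat} (A B : 'M[R]_(p, q)) : R :=
  \sum_(i < p) \sum_(j < q) A i j * B i j.

Section dimension.
Context {p q : nat}.
Implicit Types A B C : 'M[R]_(p, q).

Lemma frobC A B : frob A B = frob B A.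
Proof. by apply: eq_bigr => i _; apply: eq_bigr => j _; rewrite mulrC. Qed.

Lemma frobDl A B C : frob (A + B) C = frob A C + frob B C.
Proof.
rewrite /frob -big_split; apply: eq_bigr => i _ /=.
by rewrite -big_split; apply: eq_bigr => j _ /=; rewrite mxE mulrDl.
Qed.

Lemma frobZl c A B : frob (c *: A) B = c * frob A B.
Proof.
rewrite /frob big_distrr; apply: eq_bigr => i _ /=.
by rewrite big_distrr; apply: eq_bigr => j _ /=; rewrite mxE mulrA.
Qed.

Lemma frobNl A B : frob (- A) B = - frob A B.
Proof. by rewrite -scaleN1r frobZl mulN1r. Qed.

Lemma frobDr A B C : frob A (B + C) = frob A B + frob A C.
Proof. by rewrite frobC frobDl !(frobC A). Qed.

Lemma frobZr c A B : frob A (c *: B) = c * frob A B.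
Proof. by rewrite frobC frobZl frobC. Qed.

Lemma frobNr A B : frob A (- B) = - frob A B.
Proof. by rewrite frobC frobNl frobC. Qed.

Definition frobE := (frobDl, frobDr, frobNl, frobNr, frobZl, frobZr).

Lemma frob_ge0 A : 0 <= frob A A.
Proof. by apply: sumr_ge0 => i _; apply: sumr_ge0 => j _; rewrite -expr2 sqr_ge0. Qed.

Lemma enorm_ge0 A : 0 <= enorm A.
Proof. exact: sqrtr_ge0. Qed.

Lemma sqr_enorm A : enorm A ^+ 2 = frob A A.
Proof.
rewrite sqr_sqrtr; last by apply: sumr_ge0 => i _; apply: sumr_ge0 => j _; rewrite sqr_ge0.
by apply: eq_bigr => i _; apply: eq_bigr => j _; rewrite expr2.
Qed.

(** The square of [a *: A - B] is nonnegative. *)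
Lemma frob_young a A B : 0 < a ->
  2 * frob A B <= a * frob A A + a^-1 * frob B B.
Proof.
move=> a0; have := frob_ge0 (a *: A - B).
rewrite !frobE (frobC B A) => h.
rewrite -(ler_pM2l a0) mulrDr [a * (a^-1 * _)]mulrA mulfV ?gt_eqF// mul1r.
nra.
Qed.

Lemma frob_mxtrace A B : frob A B = \tr (A *m B^T).
Proof.
by apply: eq_bigr => i _; rewrite mxE; apply: eq_bigr => j _; rewrite mxE.
Qed.

End dimension.

Lemma inner_frob n (x y : 'cV[R]_n) : inner x y = frob x y.
Proof. by apply: eq_bigr => i _; rewrite big_ord1. Qed.

Lemma frob_mul_trl n d (x : 'cV[R]_n) (H : 'cV[R]_d) (b : 'M[R]_(n, d)) :
  frob x (b *m H) = frob (x *m H^T) b.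
Proof. by rewrite !frob_mxtrace trmx_mul mulmxA. Qed.

Lemma frob_mull n d (a : 'cV[R]_n) (H : 'cV[R]_d) (b : 'M[R]_(n, d)) :
  frob a (b *m H) = frob H (b^T *m a).
Proof.
by rewrite frobC !frob_mxtrace trmx_mul trmxK mulmxA mxtrace_mulC mulmxA
   mxtrace_mulC mulmxA.
Qed.

Lemma frob_mul2 n d (H : 'cV[R]_d) (b : 'M[R]_(n, d)) :
  frob (b *m H) (b *m H) = frob (H *m H^T) (b^T *m b).
Proof. by rewrite frob_mull mulmxA !frob_mxtrace !trmx_mul !mulmxA. Qed.

Lemma frob_scalar n d (c : R) (b : 'M[R]_(n, d)) :
  frob c%:M (b^T *m b) = c * frob b b.
Proof.
rewrite !frob_mxtrace trmx_mul trmxK mul_scalar_mx mxtraceZ.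
by rewrite mxtrace_mulC.
Qed.

End frobenius.

(** * Pointwise estimates on one step *)

Section driver_bounds.
Context {R : realType} {n d : nat}.
Variables (f : 'cV[R]_n -> 'M[R]_(n, d) -> 'cV[R]_n).

(** Along a short segment from 0, monotonicity forces f to move by at least
    [- My] times the length of the segment, and local Lipschitz continuity by
    little more than [Ly] times it: the superlinear factor is at most
    1 + 1/4 for a segment of length 1/4, because [m - 1 >= 1]. *)
Lemma Mon_RegY_bound (My Ly : R) (m : nat) : (0 < n)%N -> (2 <= m)%N -> 0 < Ly ->
  driver_Mon f My -> driver_RegY f Ly m -> - My <= 5 / 4 * Ly.
Proof.
case: n f => // k g _ hm Ly0 hMon hReg.
pose y : 'cV[R]_k.+1 := 0; pose y' : 'cV[R]_k.+1 := 4^-1 *: delta_mx 0 0.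
have y'0 : y' - y = y' by rewrite /y subr0.
have ny : enorm y = 0.
  by rewrite /enorm big1 ?sqrtr0// => i _; rewrite big1// => j _; rewrite mxE expr0n.
have ny' : frob y' y' = 16^-1.
  rewrite !frobE /frob (bigD1 0)//= big_ord1 !mxE !eqxx/= big1 ?addr0.
    by lra.
  by move=> i /negPf i0; rewrite big_ord1 !mxE i0 mul0r.
have ey' : enorm y' = 4^-1.
  apply/eqP; rewrite -(@eqrXn2 _ 2)// ?enorm_ge0 ?invr_ge0//.
  by rewrite sqr_enorm ny'; apply/eqP; field.
clearbody y'.
have := hReg y y' 0; have := hMon y y' 0.
rewrite y'0 ny ey' inner_frob expr0n (_ : (m - 1 == 0)%N = false); last first.
  by apply/negbTE; rewrite -lt0n subn_gt0.
rewrite addr0 => mon reg.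
have reg' : enorm (g y' 0 - g y 0) <= 5 / 4 * Ly * 4^-1.
  apply: (le_trans reg); rewrite ler_pM2r; last by lra.
  rewrite mulrC ler_pM2r// (_ : 5 / 4 = 1 + 4^-1); last by field.
  rewrite lerD2l -[leRHS]expr1; apply: ler_wiXn2l; [lra|lra|].
  by rewrite subn_gt0.
have := ler_pM (enorm_ge0 _) (enorm_ge0 _) reg' reg'.
rewrite -!expr2 sqr_enorm => regsq.
have a0 : 0 < 5 / 4 * Ly by lra.
have := frob_young (- y') (g y' 0 - g y 0) a0.
rewrite !frobE ny' => yg.
have : (5 / 4 * Ly)^-1 * frob (g y' 0 - g y 0) (g y' 0 - g y 0)
    <= (5 / 4 * Ly)^-1 * (5 / 4 * Ly / 4) ^+ 2.
  by rewrite ler_pM2l// invr_gt0.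
rewrite (_ : _ * _ ^+ 2 = 5 / 64 * Ly); last by field; rewrite gt_eqF.
move: mon yg; rewrite !frobE; lra.
Qed.

(** [(1 + 2 s)^2 <= 3 + 6 s^2] with [s = r ^+ (m - 1)] turns the local bound into
    a Lipschitz bound on the ball whose constant is a sum of two terms, which
    the two bounds on the step size control separately. *)
Lemma RegY_ball (Ly r : R) (m : nat) (y y' : 'cV[R]_n) (z : 'M[R]_(n, d)) :
  0 <= Ly -> driver_RegY f Ly m -> enorm y <= r -> enorm y' <= r ->
  frob (f y' z - f y z) (f y' z - f y z)
    <= Ly ^+ 2 * (3 + 6 * r ^+ (2 * (m - 1))) * frob (y' - y) (y' - y).
Proof.
move=> Ly0 hReg yr y'r; rewrite -!sqr_enorm.
have r0 : 0 <= r := le_trans (enorm_ge0 y) yr.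
set s := r ^+ (m - 1).
have s0 : 0 <= s by rewrite exprn_ge0.
have le1 : enorm (f y' z - f y z) <= Ly * (1 + 2 * s) * enorm (y' - y).
  apply: le_trans (hReg y y' z) _; rewrite ler_wpM2r ?enorm_ge0//.
  rewrite ler_wpM2l//.
  have : enorm y ^+ (m - 1) <= s by apply: lerXn2r; rewrite ?nnegrE ?enorm_ge0.
  have : enorm y' ^+ (m - 1) <= s by apply: lerXn2r; rewrite ?nnegrE ?enorm_ge0.
  lra.
have := ler_pM (enorm_ge0 _) (enorm_ge0 _) le1 le1.
rewrite -!expr2 => /le_trans; apply.
rewrite exprMn ler_wpM2r ?sqr_ge0// exprMn ler_wpM2l ?sqr_ge0//.
rewrite mulnC exprM -/s; have := sqr_ge0 (s - 1); nra.
Qed.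

(** The second bound on [h] is [h `^ (1 - 2 (m - 1) alpha) <= c] in disguise, and
    the power on the left is [h] times [(h `^ (- alpha)) ^+ (2 (m - 1))], the part
    of the squared Lipschitz constant that grows with the radius.  A vanishing
    [Ly] is excluded because the first bound would then read [h <= 0]. *)
Lemma step_size_bounds (mu Ly R0 alpha h : R) (m : nat) :
  (0 < d)%N -> (2 <= m)%N -> 0 < mu -> 0 < h -> 0 < R0 -> 0 <= Ly ->
  0 < alpha < 1 / (2 * (m - 1)%:R) ->
  h <= Num.min
     (mu / 4 * (1 / (3 * (d + 1)%:R * Ly ^+ 2)))
     ((mu / 4 * (1 / (6 * (d + 1)%:R * Ly ^+ 2 * R0 ^+ (2 * (m - 1)))))
        `^ (1 / (1 - 2 * (m - 1)%:R * alpha))) ->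
  [/\ 0 < Ly, 24 * Ly ^+ 2 * h <= mu &
    h * (Ly ^+ 2 * (3 + 6 * (R0 * h `^ (- alpha)) ^+ (2 * (m - 1)))) <= mu / 4].
Proof.
move=> d0 hm mu0 h0 R00 Ly0 /andP[al0 al1]; rewrite le_min => /andP[h1 h2].
have Lyp : 0 < Ly.
  rewrite lt_neqAle Ly0 andbT eq_sym; apply/negP => /eqP Ly00.
  by move: h1; rewrite Ly00 expr0n mulr0 invr0 !mulr0 leNgt h0.
have L2 : 0 < Ly ^+ 2 by rewrite exprn_gt0.
have dd : 2 <= (d + 1)%:R :> R by rewrite ler_nat addn1 ltnS.
have D0 : 0 < (d + 1)%:R :> R by lra.
have mm : 0 < (m - 1)%:R :> R by rewrite ltr0n subn_gt0.
have Rm : 0 < R0 ^+ (2 * (m - 1)) by rewrite exprn_gt0.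
have c1 : h * (3 * (d + 1)%:R * Ly ^+ 2) <= mu / 4.
  by move: h1; rewrite mul1r ler_pdivlMr// !mulr_gt0.
have c2 : h * (6 * Ly ^+ 2 * (d + 1)%:R * (R0 * h `^ (- alpha)) ^+ (2 * (m - 1))) <= mu / 4.
  have th0 : 0 < 1 - 2 * (m - 1)%:R * alpha.
    by move: al1; rewrite ltr_pdivlMr; nra.
  set th := 1 - 2 * (m - 1)%:R * alpha in th0 h2 *.
  set c := _ * (1 / _) in h2.
  have cge : 0 <= c.
    by rewrite /c mul1r mulr_ge0 ?invr_ge0// ?divr_ge0 ?mulr_ge0 ?sqr_ge0// ltW.
  have : h `^ th <= c.
    have th1 : (1 / th) * th = 1 by rewrite mul1r mulVf ?gt_eqF.
    rewrite -[leRHS]powRr1// -th1 powRrM; apply: ge0_ler_powR => //.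
    - exact: ltW.
    - by rewrite nnegrE ltW.
    - by rewrite nnegrE powR_ge0.
  have -> : th = 1 + - alpha * (2 * (m - 1))%:R by rewrite natrM /th; ring.
  rewrite powRD; last by rewrite (gt_eqF h0) implybT.
  rewrite (powRr1 (ltW h0)) (powRrM h) powR_mulrn ?powR_ge0//.
  rewrite /c mul1r ler_pdivlMr; last by rewrite !mulr_gt0.
  by congr (_ <= _); rewrite exprMn; ring.
split=> //; first by nra.
have : (d + 1)%:R * (h * (Ly ^+ 2 * (3 + 6 * (R0 * h `^ (- alpha)) ^+ (2 * (m - 1)))))
  <= mu / 2 by move: c1 c2; lra.
set k := h * _.
have k0 : 0 <= k.
  rewrite mulr_ge0 ?(ltW h0)// mulr_ge0 ?(ltW L2)// addr_ge0// mulr_ge0//.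
  by rewrite exprn_ge0// mulr_ge0 ?powR_ge0// ltW.
nra.
Qed.

End driver_bounds.
(** Here [x] is the difference of the inputs, [A] and [B] are the changes of the
    driver caused by y and by z, and [z] stands for the squared change of z.
    The inner product of [B] with [x + h *: A] is kept together, since the latter
    vector is no longer than [x].  Young's inequality with weight
    (15/16) mu for this product, and with weight 1/4 for that of [A] and [B],
    adds up to exactly the available dissipation:
    - 2 + 1/4 + 15/16 + (5/4)(1/4) = - 1/2 in units of [mu * h]. *)
Lemma energy_estimate {R : realType} {n : nat} (mu h K2 L z : R) (x A B : 'cV[R]_n) :
  0 < mu -> 0 < h -> mu * h <= 25 / 384 -> h * K2 <= mu / 4 -> 4 * L ^+ 2 <= mu ->
  0 <= z -> frob x A <= - mu * frob x x -> frob A A <= K2 * frob x x ->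
  frob B B <= L ^+ 2 * z ->
  frob (x + h *: (A + B)) (x + h *: (A + B)) + h ^+ 2 * frob (A + B) (A + B)
    <= (1 - mu / 2 * h) * frob x x + 3 / 8 * h * z.
Proof.
move=> mu0 h0 muh hK2 Lmu z0 xA AA BB.
have x0 := frob_ge0 x.
have hAA : h * frob A A <= mu / 4 * frob x x by nra.
have BB' : frob B B <= mu / 4 * z by nra.
have p_le : frob (x + h *: A) (x + h *: A) <= frob x x.
  have -> : frob (x + h *: A) (x + h *: A)
      = frob x x + h * (2 * frob x A + h * frob A A).
    by rewrite !frobE (frobC A x); ring.
  rewrite gerDl pmulr_rle0//; have := mulr_ge0 (ltW mu0) x0; lra.
have a0 : 0 < 15 / 16 * mu by lra.
have yx := frob_young (x + h *: A) B a0.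
have yA : 2 * frob A B <= 4^-1 * frob A A + 4 * frob B B.
  by rewrite -{2}[4](invrK 4); apply: frob_young.
have iB : (15 / 16 * mu)^-1 * frob B B <= 4 / 15 * z.
  by rewrite ler_pdivrMl//; lra.
have -> : frob (x + h *: (A + B)) (x + h *: (A + B)) + h ^+ 2 * frob (A + B) (A + B)
  = frob x x + h * (2 * frob x A) + h * (h * frob A A)
    + h * (2 * frob (x + h *: A) B) + h * (h * (frob B B + frob (A + B) (A + B))).
  by rewrite !frobE (frobC A x) (frobC B x) (frobC B A); ring.
have -> : frob (A + B) (A + B) = frob A A + 2 * frob A B + frob B B.
  by rewrite !frobE (frobC B A); ring.
have e1 : 2 * frob (x + h *: A) B <= 15 / 16 * mu * frob x x + 4 / 15 * z.
  by apply: (le_trans yx); apply: lerD => //; rewrite ler_pM2l.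
have e2 : h * (frob B B + (frob A A + 2 * frob A B + frob B B))
    <= 5 / 16 * mu * frob x x + 25 / 256 * z.
  have : h * (mu / 4 * z) <= 25 / 1536 * z by nra.
  nra.
have : h * (2 * frob x A) + h * (h * frob A A)
    + h * (2 * frob (x + h *: A) B) + h * (h * (frob B B + (frob A A + 2 * frob A B + frob B B)))
  <= h * (- (mu / 2) * frob x x + 3 / 8 * z).
  by rewrite -!mulrDr ler_pM2l//; lra.
lra.
Qed.

(** * Conditional expectations *)

Section conditional_expectation.
Context {R : realType} {disp : measure_display} {Om : measurableType disp}.
Variables (P : probability Om R) (gen : set (set Om)).
Let G : set (set Om) := <<s gen >>.

(** This makes the closure properties of measurable functions available for a
    sub-sigma-algebra. *)
Lemma measurable_wrtP {disp' : measure_display} {U : measurableType disp'}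
    (X : Om -> U) :
  measurable_wrt G X <->
  measurable_fun [set: g_sigma_algebraType gen] (X : g_sigma_algebraType gen -> U).
Proof.
split=> [mX _ B mB|mX _ [B mB <-]]; last exact: mX.
by apply: mX; exists B.
Qed.

Hypothesis G_measurable : G `<=` measurable.

Lemma measurable_wrt_measurable {disp' : measure_display}
    {U : measurableType disp'} (X : Om -> U) :
  measurable_wrt G X -> measurable_fun setT X.
Proof. by move=> mX _ B mB; apply: G_measurable; apply: mX; exists B. Qed.

Lemma is_cond_exp_cst (c : R) : is_cond_exp P G (fun=> c) (fun=> c).
Proof.
have ic : P.-integrable setT (EFin \o (fun=> c)) by exact: finite_measure_integrable_cst.
split=> //; apply/measurable_wrtP; exact: measurable_cst.
Qed.

Lemma is_cond_expD X1 E1 X2 E2 :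
  is_cond_exp P G X1 E1 -> is_cond_exp P G X2 E2 ->
  is_cond_exp P G (fun w => X1 w + X2 w) (fun w => E1 w + E2 w).
Proof.
move=> [iX1 mE1 iE1 e1] [iX2 mE2 iE2 e2].
split.
- exact: (integrableD measurableT iX1 iX2).
- by apply/measurable_wrtP; apply: measurable_funD; apply/measurable_wrtP.
- exact: (integrableD measurableT iE1 iE2).
move=> A GA; have mA := G_measurable GA.
have iA f : P.-integrable setT f -> P.-integrable A f.
  by apply: integrableS => //.
transitivity (\int[P]_(w in A) (E1 w)%:E + \int[P]_(w in A) (E2 w)%:E)%E.
  exact: (integralD mA (iA _ iE1) (iA _ iE2)).
by rewrite e1// e2//; apply/esym; exact: (integralD mA (iA _ iX1) (iA _ iX2)).
Qed.

Lemma is_cond_expZ c X E : is_cond_exp P G X E ->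
  is_cond_exp P G (fun w => c * X w) (fun w => c * E w).
Proof.
move=> [iX mE iE e].
split.
- exact: (integrableZl measurableT c iX).
- apply/measurable_wrtP; apply: measurable_funM => //.
  exact/measurable_wrtP.
- exact: (integrableZl measurableT c iE).
move=> A GA; have mA := G_measurable GA.
have iA f : P.-integrable setT f -> P.-integrable A f.
  by apply: integrableS => //.
transitivity (c%:E * \int[P]_(w in A) (E w)%:E)%E.
  exact: (integralZl mA (iA _ iE) c).
by rewrite e//; apply/esym; exact: (integralZl mA (iA _ iX) c).
Qed.

Lemma is_cond_exp_sum (I : Type) (r : seq I) (X E : I -> Om -> R) :
  (forall i, is_cond_exp P G (X i) (E i)) ->
  is_cond_exp P G (fun w => \sum_(i <- r) X i w) (fun w => \sum_(i <- r) E i w).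
Proof.
move=> XE; elim: r => [|i r IH].
  under eq_fun do rewrite big_nil; under [X in is_cond_exp _ _ _ X]eq_fun do rewrite big_nil.
  exact: is_cond_exp_cst.
under eq_fun do rewrite big_cons; under [X in is_cond_exp _ _ _ X]eq_fun do rewrite big_cons.
exact: is_cond_expD.
Qed.

Lemma is_mx_cond_exp_frob p q (X E : Om -> 'M[R]_(p, q)) B :
  is_mx_cond_exp P G X E ->
  is_cond_exp P G (fun w => frob (X w) B) (fun w => frob (E w) B).
Proof.
move=> XE; rewrite /frob.
apply: (@is_cond_exp_sum _ _ (fun i w => \sum_(j < q) X w i j * B i j)
  (fun i w => \sum_(j < q) E w i j * B i j)) => i.
apply: (@is_cond_exp_sum _ _ (fun j w => X w i j * B i j)
  (fun j w => E w i j * B i j)) => j.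
under eq_fun do rewrite mulrC; under [X in is_cond_exp _ _ _ X]eq_fun do rewrite mulrC.
exact: is_cond_expZ.
Qed.

Lemma is_mx_cond_expB p q (X1 E1 X2 E2 : Om -> 'M[R]_(p, q)) :
  is_mx_cond_exp P G X1 E1 -> is_mx_cond_exp P G X2 E2 ->
  is_mx_cond_exp P G (fun w => X1 w - X2 w) (fun w => E1 w - E2 w).
Proof.
move=> XE1 XE2 i j.
under eq_fun do rewrite !mxE -mulN1r.
under [X in is_cond_exp _ _ _ X]eq_fun do rewrite !mxE -mulN1r.
by apply: is_cond_expD => //; apply: is_cond_expZ.
Qed.

Lemma measurable_wrt_frob p q (X Y : Om -> 'M[R]_(p, q)) :
  mx_measurable_wrt G X -> mx_measurable_wrt G Y ->
  measurable_wrt G (fun w => frob (X w) (Y w)).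
Proof.
move=> mX mY; apply/measurable_wrtP.
rewrite /frob; apply: measurable_sum => i; apply: measurable_sum => j.
by apply: measurable_funM; apply/measurable_wrtP.
Qed.

(** Let [A k] be the event of [G] on which [V] and [|g|] are at most [k] and the
    conclusion fails by at least [1 / (k + 1)].  All functions are integrable on
    [A k], and integrating [F <= rho X + g] over it shows that [P (A k)] is at
    most 0.  These events cover the set where the conclusion fails: where [V] is
    infinite it holds trivially. *)
Lemma cond_exp_le (rho : R) (F E X g : Om -> R) (V : Om -> \bar R) :
  0 < rho -> is_cond_exp P G F E -> is_nneg_cond_exp P G X V ->
  measurable_wrt G g ->
  (forall w, F w <= rho * X w + g w) ->
  {ae P, forall w, ((E w)%:E <= rho%:E * V w + (g w)%:E)%E}.
Proof.
move=> rho0 [iF mE iE eF] [mX X0 mV V0 eV] mg FX.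
pose A k : set Om := [set w | (V w <= k%:R%:E)%E] `&`
  ([set w | (`|g w| <= k%:R)] `&`
   [set w | (rho%:E * V w + (g w + k.+1%:R^-1)%:E <= (E w)%:E)%E]).
have GA k : G (A k).
  have mV' := (measurable_wrtP _).1 mV.
  have mg' := (measurable_wrtP _).1 mg.
  have mE' := (measurable_wrtP _).1 mE.
  apply: (@measurableI _ (g_sigma_algebraType gen)).
    rewrite -[X in measurable X]setTI.
    apply: measurable_lee => //.
  apply: (@measurableI _ (g_sigma_algebraType gen)).
    rewrite -[X in measurable X]setTI.
    apply: measurable_fun_le => //.
    exact: measurableT_comp.
  rewrite -[X in measurable X]setTI.
  apply: measurable_lee => //.
    apply: emeasurable_funD.
      exact: measurable_funeM.
    apply/measurable_EFinP; exact: measurable_funD.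
  exact/measurable_EFinP.
have PA k : P (A k) = 0%E.
  have mA := G_measurable (GA k).
  set e := k.+1%:R^-1 : R.
  have e0 : 0 < e by rewrite invr_gt0.
  have mVA : measurable_fun (A k) V.
    by apply: measurable_funTS; exact: measurable_wrt_measurable.
  have iV : P.-integrable (A k) V.
    apply: (le_integrable mA mVA _ (finite_measure_integrable_cst P k%:R mA)).
    move=> w [/= Vk _]; rewrite gee0_abs//.
    by rewrite ger0_norm.
  have ig : P.-integrable (A k) (EFin \o g).
    apply: (le_integrable mA _ _ (finite_measure_integrable_cst P k%:R mA)).
      apply/measurable_EFinP/measurable_funTS; exact: measurable_wrt_measurable.
    by move=> w [_ [/= gk _]]; rewrite lee_fin [leRHS]ger0_norm.
  have iX : P.-integrable (A k) (EFin \o X).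
    apply/integrableP; split; first exact/measurable_EFinP/measurable_funTS.
    under eq_integral => w _ do rewrite /= ger0_norm//.
    rewrite -eV; last exact: GA.
    by have := integrable_fin_num mA iV; rewrite fin_numE ltey => /andP[].
  have iE' := integrableS measurableT mA (@subsetT _ (A k)) iE.
  have iF' := integrableS measurableT mA (@subsetT _ (A k)) iF.
  have ie := finite_measure_integrable_cst P e mA.
  have : (\int[P]_(w in A k) (rho%:E * V w + (g w + e)%:E)
      <= \int[P]_(w in A k) (rho%:E * (X w)%:E + (g w)%:E))%E.
    apply: (@le_trans _ _ (\int[P]_(w in A k) (E w)%:E)%E).
      apply: le_integral => //.
        apply: integrableD => //; first exact: integrableZl.
        exact: integrableD ig ie.
      by move=> w /set_mem[_ []].
    rewrite eF; last exact: GA.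
    apply: le_integral => //.
      by apply: integrableD => //; exact: integrableZl.
    by move=> w _; rewrite -EFinM -EFinD lee_fin.
  rewrite integralD//; last 2 first.
  - exact: integrableZl.
  - exact: (integrableD mA ig ie).
  rewrite integralD//; last exact: integrableZl.
  have -> : (\int[P]_(w in A k) (g w + e)%:E
      = \int[P]_(w in A k) (g w)%:E + e%:E * P (A k))%E.
    by rewrite -integral_cst//; exact: (integralD mA ig ie).
  rewrite !integralZl//.
  rewrite eV; last exact: GA.
  have fX := integrable_fin_num mA iX; have fg := integrable_fin_num mA ig.
  have fin : (rho%:E * \int[P]_(w in A k) (X w)%:E + \int[P]_(w in A k) (g w)%:E)%E
      \is a fin_num by rewrite fin_numD fin_numM.
  have PAfin : P (A k) \is a fin_num by exact: fin_num_measure.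
  rewrite addeA -(fineK fin) -(fineK PAfin) -EFinM -EFinD lee_fin gerDl.
  rewrite pmulr_rle0// => P0; congr EFin; apply/eqP.
  by rewrite eq_le P0 fine_ge0.
have : P.-negligible (\bigcup_k A k).
  by apply: negligible_bigcup => k; exists (A k); split;
    [exact: G_measurable|exact: PA|].
apply: negligibleS => w /= /negP; rewrite -ltNge => Ew.
have Vfin : V w \is a fin_num.
  rewrite ge0_fin_numE// ltey; apply/negP => /eqP Vy.
  by move: Ew; rewrite Vy gt0_muley ?lte_fin.
have [v vE] : exists v, V w = v%:E by exists (fine (V w)); rewrite fineK.
move: Ew; rewrite vE -EFinM -EFinD lte_fin => Ew.
have e0 : 0 < E w - (rho * v + g w) by rewrite subr_gt0.
pose b := Num.max v (Num.max `|g w| (E w - (rho * v + g w))^-1).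
exists (Num.truncn b).+1 => //.
have hb : b <= (Num.truncn b).+1%:R by apply: ltW; exact: truncnS_gt.
move: hb; rewrite !ge_max => /and3P[b1 b2 b3].
split; [by rewrite /= vE lee_fin|split=> //=].
rewrite vE -EFinM -EFinD lee_fin.
rewrite addrA -lerBrDl -[leRHS]invrK lef_pV2 ?posrE ?invr_gt0//.
by rewrite (le_trans b3)// ler_nat.
Qed.

End conditional_expectation.

(** * Countable families and the filtration *)

Lemma approx_ratr {R : realType} {p q : nat} (A : 'M[R]_(p, q)) (e : R) : 0 < e ->
  exists a : 'M[rat]_(p, q), frob (A - map_mx ratr a) (A - map_mx ratr a) <= e.
Proof.
move=> e0.
pose c := Num.min 1 (e / (p * q).+1%:R).
have c0 : 0 < c by rewrite lt_min ltr01 divr_gt0.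
have approx i j : {r : rat | ratr r \in `]A i j - c, A i j + c[}.
  apply: cid; apply: rat_in_itvoo; lra.
exists (\matrix_(i, j) sval (approx i j)).
apply: (@le_trans _ _ (\sum_(i < p) \sum_(j < q) c)).
  apply: ler_sum => i _; apply: ler_sum => j _; rewrite !mxE.
  case: (approx i j) => r /=; rewrite in_itv/= => /andP[r1 r2].
  apply: (@le_trans _ _ (c * c)); first by nra.
  by rewrite ler_piMl ?(ltW c0)// ge_min lexx.
rewrite !sumr_const !card_ord -mulrnA mulnC -mulr_natr.
apply: (@le_trans _ _ (c * (p * q).+1%:R)).
  by rewrite ler_pM2l// ler_nat.
by rewrite -ler_pdivlMr// ge_min lexx orbT.
Qed.

Lemma ae_all_countable {R : realType} {disp : measure_display} {Om : measurableType disp}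
    (P : probability Om R) (I : countType) (Q : I -> Om -> Prop) :
  (forall i, {ae P, forall w, Q i w}) -> {ae P, forall w, forall i, Q i w}.
Proof.
move=> PQ.
have : {ae P, forall w, forall k : nat, if unpickle k is Some i then Q i w else True}.
  apply: ae_foralln => k; case: (unpickle k) => [i|]; [exact: PQ|exact: aeW].
by apply: filterS => w Qw i; have := Qw (pickle i); rewrite pickleK.
Qed.

Lemma augmented_filtration_measurable {R : realType} {disp : measure_display}
    {Om : measurableType disp} (P : probability Om R) d (W : R -> Om -> 'cV[R]_d) T t :
  brownian_motion P T W -> t <= T ->
  augmented_filtration P W t `<=` measurable.
Proof.
move=> [mW _ _ _ _] tT; apply: smallest_sub; first exact: sigma_algebra_measurable.
move=> A [[s /= s0t]|[]//]; rewrite /sigma_vec /g_sigma_preimage.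
apply: smallest_sub; first exact: sigma_algebra_measurable.
elim/big_ind: _ => // [B C hB hC D [/hB|/hC]//|j _].
move=> _ [B mB <-]; apply: mW => //.
move: s0t; rewrite !in_itv/= => /andP[-> /le_trans]; exact.
Qed.


(** * Conditional Bessel inequality *)

Section conditional_bessel.
Context {R : realType} {disp : measure_display} {Om : measurableType disp}.
Variables (P : probability Om R) (gen : set (set Om)).
Let G : set (set Om) := <<s gen >>.
Hypothesis G_measurable : G `<=` measurable.
Context {n d : nat}.

(** Add up the two inequalities stating that the squared norms of
    [U - a - (h / 2) *: (b *m H)] and of [(U - D) + (h / 2) *: (b *m H)] are
    nonnegative: the first one is the Bessel inequality tested at [a] and [b], the
    second one absorbs the product of [U - D] with [b *m H].  The left side
    is affine in [U], [D *m H^T], [H] and [H *m H^T], the variables whose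
    conditional expectations are known. *)
Lemma affine_minorant (h : R) (U D a : 'cV[R]_n) (H : 'cV[R]_d) (b : 'M[R]_(n, d)) :
  2 * frob U a + (h * frob (D *m H^T) b + (- h * frob H (b^T *m a) +
    (- (h ^+ 2 / 2) * frob (H *m H^T) (b^T *m b) + - frob a a)))
  <= frob U U + frob (U - D) (U - D).
Proof.
rewrite -frob_mul_trl -frob_mull -frob_mul2; set c := b *m H.
have := frob_ge0 (U - a - (h / 2) *: c); have := frob_ge0 (U - D + (h / 2) *: c).
rewrite !frobE (frobC c U) (frobC c D) (frobC c a) (frobC a U) (frobC D U).
lra.
Qed.

(** Taking conditional expectations in the affine minorant gives, for constants
    [a] and [b], the bound for
    [|y|^2 - |y - a|^2 + (h / 2) (|zeta|^2 - |zeta - b|^2)]; the factor 1/2 in the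
    minorant is the one for which the optimal [b] is [zeta] when [Lam] is 1.  The
    exceptional set may be chosen common to all rational [a] and [b], and these
    approximate the random values [y w] and [zeta w]. *)
Lemma conditional_bessel (h Lam rho : R) (U D y : Om -> 'cV[R]_n)
    (zeta : Om -> 'M[R]_(n, d)) (H : Om -> 'cV[R]_d) (X g : Om -> R)
    (V : Om -> \bar R) :
  0 < h -> Lam <= 1 -> 0 < rho ->
  is_mx_cond_exp P G U y ->
  is_mx_cond_exp P G (fun w => D w *m (H w)^T) zeta ->
  is_mx_cond_exp P G H (fun=> 0) ->
  is_mx_cond_exp P G (fun w => H w *m (H w)^T) (fun=> (Lam * h^-1)%:M) ->
  is_nneg_cond_exp P G X V -> measurable_wrt G g ->
  (forall w, frob (U w) (U w) + frob (U w - D w) (U w - D w) <= rho * X w + g w) ->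
  {ae P, forall w,
    ((frob (y w) (y w) + h / 2 * frob (zeta w) (zeta w))%:E
      <= rho%:E * V w + (g w)%:E)%E}.
Proof.
move=> h0 Lam1 rho0 Uy Dz H0 HH XV mg UX.
have affine (a : 'cV[R]_n) (b : 'M[R]_(n, d)) : {ae P, forall w,
   ((frob (y w) (y w) - frob (y w - a) (y w - a) +
     h / 2 * (frob (zeta w) (zeta w) - frob (zeta w - b) (zeta w - b)))%:E
    <= rho%:E * V w + (g w)%:E)%E}.
  have cE : is_cond_exp P G
    (fun w => 2 * frob (U w) a + (h * frob (D w *m (H w)^T) b +
      (- h * frob (H w) (b^T *m a) +
       (- (h ^+ 2 / 2) * frob (H w *m (H w)^T) (b^T *m b) + - frob a a))))
    (fun w => 2 * frob (y w) a + (h * frob (zeta w) b +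
      (- h * frob 0 (b^T *m a) +
       (- (h ^+ 2 / 2) * frob (Lam * h^-1)%:M (b^T *m b) + - frob a a)))).
    apply: is_cond_expD => //.
      by apply: is_cond_expZ => //; exact: is_mx_cond_exp_frob.
    apply: is_cond_expD => //.
      apply: is_cond_expZ => //.
      exact: (is_mx_cond_exp_frob G_measurable _ Dz).
    apply: is_cond_expD => //.
      apply: is_cond_expZ => //.
      exact: (is_mx_cond_exp_frob G_measurable _ H0).
    apply: is_cond_expD => //; last exact: is_cond_exp_cst.
    apply: is_cond_expZ => //.
    exact: (is_mx_cond_exp_frob G_measurable _ HH).
  have := cond_exp_le G_measurable rho0 cE XV mg
    (fun w => le_trans (affine_minorant h (U w) (D w) a (H w) b) (UX w)).
  apply: filterS => w; apply: le_trans; rewrite lee_fin.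
  rewrite frob_scalar -(scale0r 0) !frobE (frobC a) (frobC b).
  rewrite [- _ * (_ * _ * _)](_ : _ = - (h / 2 * (Lam * frob b b))); last first.
    by field; rewrite gt_eqF.
  have : h / 2 * (Lam * frob b b) <= h / 2 * frob b b.
    by rewrite ler_pM2l ?divr_gt0// ler_piMl ?frob_ge0.
  lra.
have : {ae P, forall w, forall ab : 'cV[rat]_n * 'M[rat]_(n, d),
   ((frob (y w) (y w) - frob (y w - map_mx ratr ab.1) (y w - map_mx ratr ab.1) +
     h / 2 * (frob (zeta w) (zeta w) -
       frob (zeta w - map_mx ratr ab.2) (zeta w - map_mx ratr ab.2)))%:E
    <= rho%:E * V w + (g w)%:E)%E}.
  by apply: ae_all_countable => -[a b]; exact: affine.
apply: filterS => w Hw; apply/lee_addgt0Pr => e e0.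
have [a ya] : exists a : 'cV[rat]_n, _ <= e / 2 := approx_ratr (y w) (divr_gt0 e0 (ltr0Sn _ 1)).
have [b zb] := approx_ratr (zeta w) (divr_gt0 e0 h0).
apply: le_trans (leeD2r e%:E (Hw (a, b))); rewrite -EFinD lee_fin /=.
have : h / 2 * frob (zeta w - map_mx ratr b) (zeta w - map_mx ratr b) <= e / 2.
  have : h / 2 * (e / h) = e / 2 by field; rewrite gt_eqF.
  by move=> <-; rewrite ler_pM2l// divr_gt0.
lra.
Qed.

End conditional_bessel.

(** * Contraction *)

Theorem mainTheorem3 (R : realType) (disp : measure_display)
  (Om : measurableType disp) (P : probability Om R)
  (n d : nat) (hn : (0 < n)%N) (hd : (0 < d)%N)
  (T : R) (hT : 0 < T)
  (N : nat) (hN : (0 < N)%N) (h : R) (hh : h = T / N%:R)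
  (W : R -> Om -> 'cV[R]_d) (hW : brownian_motion P T W)
  (f : 'cV[R]_n -> 'M[R]_(n, d) -> 'cV[R]_n)
  (My Ly Lz : R) (hLy : 0 <= Ly) (hLz : 0 <= Lz) (m : nat) (hm : (2 <= m)%N)
  (hMon : driver_Mon f My) (hRegY : driver_RegY f Ly m)
  (hRegZ : driver_RegZ f Lz)
  (R0 alpha : R) (hR0 : 0 < R0)
  (Th : 'cV[R]_n -> 'cV[R]_n) (hTh : ball_projection (R0 * h `^ (- alpha)) Th)
  (Lam C : R) (hLam : 0 < Lam <= 1)
  (H : nat -> Om -> 'cV[R]_d) (hH : scheme_weights P W h N Lam C H)
  (hMy : My < 0) (hLzMy : 4 * Lz ^+ 2 <= - My)
  (halpha : 0 < alpha < 1 / (2 * (m - 1)%:R))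
  (hstep : h <= Num.min
     ((- My) / 4 * (1 / (3 * (d + 1)%:R * Ly ^+ 2)))
     (((- My) / 4 * (1 / (6 * (d + 1)%:R * Ly ^+ 2 * R0 ^+ (2 * (m - 1)))))
        `^ (1 / (1 - 2 * (m - 1)%:R * alpha)))) :
  My / 2 < 0 /\
  forall (i : nat), (i < N)%N ->
  forall (Yin1 Yin2 Y1 Y2 : Om -> 'cV[R]_n) (Z1 Z2 : Om -> 'M[R]_(n, d))
    (V : Om -> \bar R),
  let Fi := augmented_filtration P W (tgrid h i) in
  let Fi1 := augmented_filtration P W (tgrid h i.+1) in
  mx_measurable_wrt Fi1 Yin1 -> mx_measurable_wrt Fi1 Yin2 ->
  full_projection_step P Fi h f Th (H i.+1) Yin1 Y1 Z1 ->
  full_projection_step P Fi h f Th (H i.+1) Yin2 Y2 Z2 ->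
  is_nneg_cond_exp P Fi (fun w => enorm (Yin1 w - Yin2 w) ^+ 2) V ->
  {ae P, forall w,
    ((enorm (Y1 w - Y2 w) ^+ 2 + 1 / 8 * enorm (Z1 w - Z2 w) ^+ 2 * h)%:E
     <= (expR (My / 2 * h))%:E * V w)%E}.
Proof.
split; first by rewrite pmulr_llt0 ?invr_gt0.
move=> i iN Yin1 Yin2 Y1 Y2 Z1 Z2 V Fi Fi1 _ _ [Z1E Y1E] [Z2E Y2E] XV.
have h0 : 0 < h by rewrite hh divr_gt0// ltr0n.
have [_ _ H0 HH _] := hH i iN.
have Fi_measurable : Fi `<=` measurable.
  apply: (augmented_filtration_measurable hW); rewrite /tgrid hh mulrCA.
  by rewrite ger_pMr// ler_pdivrMr ?ltr0n// mul1r ler_nat ltnW.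
have [Ly0 Lyh hK] := step_size_bounds hd hm (mu := - My) (alpha := alpha)
  ltac:(by rewrite oppr_gt0) h0 hR0 hLy halpha hstep.
have mu0 : 0 < - My by rewrite oppr_gt0.
have muLy := Mon_RegY_bound hn hm Ly0 hMon hRegY.
have muh : - My * h <= 25 / 384.
  (* mu^2 h <= (25/16) Ly^2 h <= (25/16) (mu / 24) *)
  have sq : My ^+ 2 <= 25 / 16 * Ly ^+ 2 by nra.
  rewrite -(ler_pM2l mu0); have : My ^+ 2 * h <= 25 / 16 * Ly ^+ 2 * h by rewrite ler_pM2r.
  lra.
set r := R0 * h `^ (- alpha) in hTh hK *.
have [_ Th_r _ Th_lip] := hTh.
pose dT w := Th (Yin1 w) - Th (Yin2 w).
pose df w := f (Th (Yin1 w)) (Z1 w) - f (Th (Yin2 w)) (Z2 w).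
pose dZ w := Z1 w - Z2 w.
have dY : is_mx_cond_exp P Fi (fun w => dT w + h *: df w) (fun w => Y1 w - Y2 w).
  have := is_mx_cond_expB Fi_measurable Y1E Y2E.
  rewrite (_ : (fun w => _ - (_ + _)) = (fun w => dT w + h *: df w))//.
  by apply/funext => w; rewrite /dT /df scalerBr opprD addrACA.
have dZE : is_mx_cond_exp P Fi (fun w => dT w *m (H i.+1 w)^T) dZ.
  have := is_mx_cond_expB Fi_measurable Z1E Z2E.
  rewrite (_ : (fun w => _ - _ *m _) = (fun w => dT w *m (H i.+1 w)^T))//.
  by apply/funext => w; rewrite /dT mulmxBl.
have mdZ : measurable_wrt Fi (fun w => 3 / 8 * h * frob (dZ w) (dZ w)).
  have mZ : mx_measurable_wrt Fi dZ by move=> k j; case: (dZE k j).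
  apply/measurable_wrtP; apply: measurable_funM => //.
  by apply/measurable_wrtP; exact: measurable_wrt_frob.
have bound w : frob (dT w + h *: df w) (dT w + h *: df w)
    + frob (dT w + h *: df w - dT w) (dT w + h *: df w - dT w)
  <= expR (My / 2 * h) * enorm (Yin1 w - Yin2 w) ^+ 2 + 3 / 8 * h * frob (dZ w) (dZ w).
  rewrite [_ + _ - dT w]addrAC subrr add0r [frob (h *: _) _]frobZl frobZr mulrA -expr2.
  pose A := f (Th (Yin1 w)) (Z1 w) - f (Th (Yin2 w)) (Z1 w).
  pose B := f (Th (Yin2 w)) (Z1 w) - f (Th (Yin2 w)) (Z2 w).
  have -> : df w = A + B by rewrite /df /A /B addrA subrK.
  have xA : frob (dT w) A <= - - My * frob (dT w) (dT w).
    by rewrite opprK -inner_frob -sqr_enorm; exact: hMon.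
  have BB : frob B B <= Lz ^+ 2 * frob (dZ w) (dZ w).
    rewrite -!sqr_enorm -exprMn lerXn2r ?nnegrE ?mulr_ge0 ?enorm_ge0//.
    exact: hRegZ.
  apply: le_trans (energy_estimate mu0 h0 muh hK hLzMy (frob_ge0 _) xA
    (RegY_ball _ hLy hRegY (Th_r _) (Th_r _)) BB) _.
  rewrite lerD2r -sqr_enorm; apply: ler_pM.
  - lra.
  - by rewrite sqr_ge0.
  - by have := expR_ge1Dx (My / 2 * h); lra.
  - by rewrite lerXn2r ?nnegrE ?enorm_ge0//; exact: Th_lip.
have := conditional_bessel Fi_measurable h0 (proj2 (andP hLam)) (expR_gt0 _)
  dY dZE H0 HH XV mdZ bound.
apply: filterS => w.
rewrite !sqr_enorm -leeBlDr// -EFinB; apply: le_trans.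
by rewrite lee_fin /dZ; lra.
Qed.
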